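(* For every integer $n\ge 1$, $L_p(n,2)=2^{n-1}+n-2$, where $L_p(n,2)$ is the maximum, over all unavoidable sets $S$ of patterns of length $n$ over the alphabet $\{1,2\}$, of the maximal length of an $S$-free $n$-pattern word over $\{1,2\}$.
   Context: Let $[m]=\{1,\ldots,m\}$ with its natural order; here $m=2$. A word is a finite sequence of letters; a subword means a block of consecutive letters. A pattern is a nonempty word which, for some $k\ge1$, contains each of the letters $1,\ldots,k$ at least once and no other letters. An $n$-pattern word over $[m]$ is a word over $[m]$ in which every subword of length $n$ is a pattern. For a set $S$ of patterns of length $n$ over $[m]$, a word is $S$-free if it contains no element of $S$ as a subword; $S$ is unavoidable if there is a natural number $k$ such that every $S$-free $n$-pattern word over $[m]$ has length less than $k$ (so for unavoidable $S$ the maximal length of an $S$-free $n$-pattern word is finite). *)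

(* Defs.v *)
From mathcomp Require Import all_boot.

Set Implicit Arguments.
Unset Strict Implicit.
Unset Printing Implicit Defensive.

(* Words are finite sequences of natural numbers; the alphabet [m] is {1, ..., m}
   (not 'I_m, whose letters start at 0). *)
Definition word_over (m : nat) (w : seq nat) : bool :=
  all (fun a => 1 <= a <= m) w.

Definition is_pattern (w : seq nat) : Prop :=
  w <> [::] /\ exists k, 1 <= k /\ forall a, (a \in w) = (1 <= a <= k).

(* Subwords are blocks of consecutive letters, i.e. [infix]. *)
Definition pattern_word (n m : nat) (w : seq nat) : Prop :=
  word_over m w /\
  forall u, infix u w -> size u = n -> is_pattern u.

Definition pattern_set (n m : nat) (S : pred (seq nat)) : Prop :=
  forall u, S u -> [/\ word_over m u, size u = n & is_pattern u].

Definition set_free (S : pred (seq nat)) (w : seq nat) : Prop :=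
  forall u, S u -> ~~ infix u w.

Definition unavoidable (n m : nat) (S : pred (seq nat)) : Prop :=
  exists k, forall w, pattern_word n m w -> set_free S w -> size w < k.

Definition is_maximum (A : nat -> Prop) (v : nat) : Prop :=
  A v /\ forall x, A x -> x <= v.

Definition is_max_free_length (n m : nat) (S : pred (seq nat)) : nat -> Prop :=
  is_maximum (fun l =>
    exists w, [/\ pattern_word n m w, set_free S w & size w = l]).

(* [is_Lp n m v] means L_p(n, m) = v.  The inner maximum exists for every
   unavoidable S: lengths are bounded and the empty word is S-free when n >= 1. *)
Definition is_Lp (n m : nat) : nat -> Prop :=
  is_maximum (fun l =>
    exists S, [/\ pattern_set n m S, unavoidable n m S
                & is_max_free_length n m S l]).

(* Main.v *)
Require Import Defs.
From mathcomp Require Import all_boot.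
From mathcomp Require Import fingroup perm zify.

(** Consecutive windows of length [n - 1] of an S-free pattern word form a walk
    in the de Bruijn graph on the [2 ^ (n - 1)] words of length [n - 1].  If a
    window is repeated, the word contains a closed walk, and going round it
    produces arbitrarily long S-free pattern words; this is the upper bound.
    The bound is attained by a Hamiltonian path [w] of that graph, with S the
    set of patterns of length [n] that are not subwords of [w]: an S-free
    pattern word has to follow [w] letter by letter. *)

Set Implicit Arguments.
Unset Strict Implicit.
Unset Printing Implicit Defensive.

Lemma infix_nthP (u w : seq nat) :
  infix u w <-> exists2 i, i + size u <= size w
                & forall c, c < size u -> nth 0 u c = nth 0 w (i + c).
Proof.
split=> [/infixP [p [q ->]]|[i hi huw]].
  exists (size p) => [|c hc]; first by rewrite !size_cat leq_add2l leq_addr.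
  by rewrite !nth_cat ltnNge leq_addr addKn hc.
have -> : u = take (size u) (drop i w).
  apply: (@eq_from_nth _ 0) => [|c hc].
    by rewrite size_take size_drop; case: ltnP => //; lia.
  by rewrite nth_take // nth_drop huw.
apply/infixP; exists (take i w), (drop (size u) (drop i w)).
by rewrite !cat_take_drop.
Qed.

(** The only words over two letters that fail to be patterns are the empty word and the powers of
    the letter 2. *)
Lemma is_pattern2E (u : seq nat) :
  word_over 2 u -> is_pattern u <-> 1 \in u.
Proof.
move=> /allP hu; split=> [[_ [k [hk ->]]]|h1]; first by rewrite hk.
split; first by move=> u0; rewrite u0 in h1.
have letter a : a \in u -> a = 1 \/ a = 2 by move/hu; lia.
have [h2|/negP h2] := boolP (2 \in u); [exists 2|exists 1]; split=> // a.
  apply/idP/idP => [/hu //|ha].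
  by have [->|->] : a = 1 \/ a = 2 by lia.
apply/idP/idP => [ha|ha]; last by have -> : a = 1 by lia.
by case: (letter _ ha) => ea; rewrite ea // in ha *; case: h2.
Qed.

Section DeBruijnCycle.

Variable k : nat.
Local Notation T := (k.+1.-tuple bool).

(** Such an [s] is a cycle cover of the de Bruijn graph; with a single orbit it is a Hamiltonian
    cycle. *)
Definition follows (s : {perm T}) := [forall x : T, take k (s x) == behead x].

Lemma followsP (s : {perm T}) :
  reflect (forall x : T, take k (s x) = behead x) (follows s).
Proof. exact: 'forall_eqP. Qed.

Lemma exists_follows : exists s, follows s.
Proof.
have rot_inj : injective (fun x : T => [tuple of rot 1 x]).
  by move=> x y /(congr1 val) /rot_inj /val_inj.
exists (perm rot_inj); apply/followsP => x; rewrite permE /=.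
case: x => -[|a x] //= /eqP [sx].
by rewrite rot1_cons -cats1 take_size_cat.
Qed.

(* Two cycles of [s] through vertices with the same successors can be joined by
   exchanging the images of these vertices. *)
Lemma minimal_follows_same_orbit (s : {perm T}) (x y : T) :
    follows s -> (forall t, follows t -> #|porbits s| <= #|porbits t|) ->
  behead x = behead y -> x \in porbit s y.
Proof.
move=> /followsP fs smin exy; apply: contraT => nxy.
have neq_xy : x != y by apply: contraNneq nxy => ->; rewrite porbit_id.
suff /smin : follows (tperm x y * s)%g.
  (* For distinct [x], [y] in different orbits, this identity says that [tperm x y * s] has one
     orbit fewer than [s], against minimality. *)
  rewrite -(leq_add2r 2); have := porbits_mul_tperm s x y.
  by rewrite /= nxy neq_xy => ->; rewrite leq_add2l.
by apply/followsP => z; rewrite permM fs; case: tpermP => // ->.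
Qed.

(** Shifting the letters of [y] one by one into [x] leads to [y], and no single shift leaves the
    orbit. *)
Lemma minimal_follows_transitive (s : {perm T}) (x y : T) :
    follows s -> (forall t, follows t -> #|porbits s| <= #|porbits t|) ->
  y \in porbit s x.
Proof.
move=> fs smin.
have shift (q : seq bool) : forall z : T,
    exists2 t : T, t \in porbit s z & tval t = drop (size q) (z ++ q).
  elim: q => [|b q IH] z.
    by exists z; rewrite ?porbit_id // cats0 drop0.
  have sz : size (rcons (behead z) b) == k.+1.
    by rewrite size_rcons size_behead size_tuple.
  have [t tz' et] := IH (Tuple sz).
  exists t; last first.
    rewrite et /=; case: (z) => -[|a z'] //= _.
    by rewrite cat_rcons.
  set z' := Tuple sz in tz' *.
  (* [s] need not send [z] to [z'], but the preimage [v] of [z'] has the same tail as [z], hence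
     lies in the orbit of [z]. *)
  pose v := (s^-1)%g z'.
  have sv : s v = z' by rewrite permKV.
  have vz : v \in porbit s z.
    apply: minimal_follows_same_orbit => //.
    have /followsP <- := fs; rewrite sv /= -cats1 take_cat.
    by rewrite size_behead size_tuple ltnn subnn take0 cats0.
  have z'z : z' \in porbit s z.
    have := porbit_perm s 1 v; rewrite expg1 sv => ez'.
    by rewrite -eq_porbit_mem ez' eq_porbit_mem.
  move: z'z tz'; rewrite -!eq_porbit_mem => /eqP-> //.
have [t tx et] := shift y x.
suff <- : t = y by [].
by apply: val_inj; rewrite /= et size_tuple drop_size_cat ?size_tuple.
Qed.

End DeBruijnCycle.

Lemma exists_transitive_follows k :
  exists2 s : {perm k.+1.-tuple bool}, follows s & forall x y, y \in porbit s x.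
Proof.
have [s0 fs0] := exists_follows k.
case: (arg_minnP (fun s => #|porbits s|) fs0) => s fs smin.
by exists s => // x y; apply: minimal_follows_transitive.
Qed.

Lemma iter_follows_nth k (s : {perm k.+1.-tuple bool}) x i c :
    follows s -> c <= k ->
  nth true (iter i s x) c = nth true (iter (i + c) s x) 0.
Proof.
move=> /followsP fs; elim: c i => [|c IH] i hc; first by rewrite addn0.
rewrite addnS -addSn -IH 1?ltnW //= -(nth_take _ hc) fs.
by rewrite nth_behead.
Qed.

(** Reading the first letters along a Hamiltonian cycle gives a word whose windows of length [k] are
    the successive vertices; the length leaves room for exactly [2 ^ k] windows. *)
Lemma exists_de_bruijn_word k : exists w,
  [/\ word_over 2 w, size w = 2 ^ k + k - 1
    & forall i j, i < 2 ^ k -> j < 2 ^ k ->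
      (forall c, c < k -> nth 0 w (i + c) = nth 0 w (j + c)) -> i = j].
Proof.
case: k => [|k]; first by exists [::]; split=> // -[|i] [|j].
have [s fs trans_s] := exists_transitive_follows k.
pose x0 := [tuple of nseq k.+1 true].
pose f i := if nth true (iter i s x0) 0 then 1 else 2.
exists (mkseq f (2 ^ k.+1 + k.+1 - 1)); split.
- by apply/allP => a /mapP [i _ ->]; rewrite /f; case: ifP.
- by rewrite size_mkseq.
move=> i j hi hj eqw.
have card_orbit : #|porbit s x0| = 2 ^ k.+1.
  by rewrite (eq_card (B := predT)) ?card_tuple ?card_bool // => y; rewrite trans_s.
have := uniq_traject_porbit s x0; rewrite card_orbit => uniq_s.
apply/eqP; rewrite -(nth_uniq x0 _ _ uniq_s) ?size_traject // !nth_traject //.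
apply/eqP/val_inj/(@eq_from_nth _ true); rewrite ?size_tuple // => c hc.
rewrite (iter_follows_nth _ i) // (iter_follows_nth _ j) //.
have := eqw c hc; rewrite !nth_mkseq; try lia.
by rewrite /f; do 2!case: nth.
Qed.

Lemma nth_word_over m w i : word_over m w -> i < size w -> 1 <= nth 0 w i <= m.
Proof. by move=> /all_nthP h /h. Qed.

Lemma nth_periodic (w : seq nat) i p k b :
    0 < p -> (forall c, c < k -> nth 0 w (i + c) = nth 0 w (i + p + c)) ->
  b < p + k -> nth 0 w (i + b) = nth 0 w (i + b %% p).
Proof.
move=> p0 per; elim/ltn_ind: b => b IH hb.
have [hbp|hpb] := ltnP b p; first by rewrite modn_small.
have eb : b = p + (b - p) by rewrite subnKC.
rewrite {1}eb addnA -per; last lia.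
by rewrite IH; [rewrite [in RHS]eb modnDl| lia | lia].
Qed.

(** Up to a multiple of [p], a block of length [k.+1] in the periodic word starts before [p], so it
    ends within the [p + k] letters on which [w] itself has period [p]. *)
Lemma infix_pumped (w : seq nat) i p k K u :
    0 < p -> i + p + k <= size w ->
    (forall c, c < k -> nth 0 w (i + c) = nth 0 w (i + p + c)) ->
    size u = k.+1 -> infix u (mkseq (fun a => nth 0 w (i + a %% p)) K) ->
  infix u w.
Proof.
move=> p0 hw per su /infix_nthP [a]; rewrite size_mkseq su => ha eu.
have hap := ltn_pmod a p0.
apply/infix_nthP; exists (i + a %% p); rewrite su; first lia.
move=> c hc; rewrite eu // nth_mkseq; last lia.
by rewrite -modnDml -addnA [RHS](nth_periodic p0 per) //; lia.
Qed.

Lemma repeated_window k w :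
    word_over 2 w -> 2 ^ k + k <= size w ->
  exists i p, [/\ 0 < p, i + p + k <= size w
    & forall c, c < k -> nth 0 w (i + c) = nth 0 w (i + p + c)].
Proof.
move=> w2 hw.
(* Pigeonhole: [2 ^ k + 1] windows, but only [2 ^ k] values. Testing for 1 loses nothing over two
   letters. *)
pose window (i : 'I_(2 ^ k).+1) := [tuple nth 0 w (i + c) == 1 | c < k].
have /injectivePn [i [j neq_ij eq_ij]] : ~~ injectiveb window.
  apply/injectiveP => /leq_card.
  by rewrite card_ord card_tuple card_bool ltnn.
wlog lt_ij : i j neq_ij eq_ij / i < j.
  move=> wlg; have [|ij] : i < j \/ j < i by move: neq_ij; rewrite -val_eqE /=; lia.
    exact: wlg.
  by apply: (wlg j i) => //; rewrite eq_sym.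
have hj := ltn_ord j.
exists i, (j - i); split; [lia|lia|move=> c hc].
have /(congr1 (fun t => tnth t (Ordinal hc))) := eq_ij.
rewrite !tnth_mktuple /= subnKC; last lia.
have h1 : i + c < size w by lia.
have h2 : j + c < size w by lia.
by have := nth_word_over w2 h1; have := nth_word_over w2 h2; lia.
Qed.

Lemma free_size_le n S w :
    0 < n -> pattern_set n 2 S -> unavoidable n 2 S ->
    pattern_word n 2 w -> set_free S w ->
  size w <= 2 ^ (n - 1) + n - 2.
Proof.
case: n => // k _ Spat [K hK] [w2 wpat] wfree; rewrite leqNgt; apply/negP => hw.
have [|i [p [p0 hp per]]] := @repeated_window k w w2.
  by move: hw; rewrite subn1 /=; lia.
(* The pumped word is given length [K], the very bound that unavoidability forbids it to reach. *)
pose t := mkseq (fun a => nth 0 w (i + a %% p)) K.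
have : size t < K; last by rewrite size_mkseq ltnn.
apply: hK.
  split=> [|u ut su]; last exact: wpat (infix_pumped p0 hp per su ut) su.
  apply/allP => a /mapP [b _ ->]; apply: nth_word_over => //.
  by have := ltn_pmod b p0; lia.
move=> u Su; apply/negP => ut; have [_ su _] := Spat u Su.
by have /negP[] := wfree u Su; apply: infix_pumped p0 hp per su ut.
Qed.

(* The positions in [w] of consecutive windows of [u] are consecutive, because
   these windows overlap in [k] letters and such a block occurs only once. *)
Lemma size_le_of_windows k (u w : seq nat) :
    k <= size w ->
    (forall i j, i + k <= size w -> j + k <= size w ->
      (forall c, c < k -> nth 0 w (i + c) = nth 0 w (j + c)) -> i = j) ->
    (forall v, infix v u -> size v = k.+1 -> infix v w) ->
  size u <= size w.
Proof.
move=> hkw inj_w sub; have [|hu] := leqP (size u) k; first by move/leq_trans; apply.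
have pos i : i + k < size u ->
    exists2 q, q + k < size w & forall c, c <= k -> nth 0 u (i + c) = nth 0 w (q + c).
  move=> hi; have sv : size (take k.+1 (drop i u)) = k.+1.
    by rewrite size_takel // size_drop; lia.
  have /infix_nthP : infix (take k.+1 (drop i u)) w.
    by apply: sub => //; apply: infix_trans (infix_take _ _) (infix_drop _ _).
  rewrite sv => -[q hq eq_q]; exists q => [|c hc]; first lia.
  by rewrite -eq_q // nth_take // nth_drop.
have [q0 hq0 eq0] := pos 0 hu.
have track i : i + k < size u -> q0 + i + k < size w /\
    forall c, c <= k -> nth 0 u (i + c) = nth 0 w (q0 + i + c).
  elim: i => [|i IH] hi; first by rewrite addn0.
  have [|hw eqi] := IH; first lia.
  have [q hq eqq] := pos _ hi.
  have -> : q0 + i.+1 = q; last by [].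
  apply: inj_w => [||c hc]; [lia|lia|].
  by rewrite -eqq 1?ltnW // addnS addSn -addnS -eqi // addnS addSn.
(* The last window of [u] fits into [w] at offset [q0] from its place in [u], so all of [u] does. *)
have [|hw _] := track (size u - k.+1); lia.
Qed.

Theorem theorem5 (n : nat) (hn : 1 <= n) : is_Lp n 2 (2 ^ (n - 1) + n - 2).
Proof.
split; last first.
  by move=> l [S [Spat Sun [[w [wpat wfree <-]] _]]]; apply: free_size_le wfree.
case: n hn => // k _.
have [w [w2 sw inj_w]] := exists_de_bruijn_word k.
have pow0 : 0 < 2 ^ k by rewrite expn_gt0.
have -> : 2 ^ (k.+1 - 1) + k.+1 - 2 = size w by rewrite subn1 /=; lia.
pose S u := [&& word_over 2 u, size u == k.+1, 1 \in u & ~~ infix u w].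
have Spat : pattern_set k.+1 2 S.
  by move=> u /and4P [u2 /eqP su u1 _]; split=> //; apply/is_pattern2E.
have size_le u : pattern_word k.+1 2 u -> set_free S u -> size u <= size w.
  move=> [u2 upat] ufree; apply: (@size_le_of_windows k); first lia.
    by move=> i j hi hj; apply: inj_w; lia.
  move=> v vu sv; apply: contraT => nvw.
  have v2 : word_over 2 v by apply/allP => a /(mem_infix vu) /(allP u2).
  suff /ufree : S v by rewrite vu.
  by rewrite /S v2 sv eqxx nvw andbT; apply/is_pattern2E/upat.
exists S; split=> //; first by exists (size w).+1.
split; last by move=> l [u [upat ufree <-]]; apply: size_le.
exists w; split=> //; last by move=> u /and4P [].
split=> // u uw su; have u2 : word_over 2 u by apply/allP => a /(mem_infix uw) /(allP w2).
apply/is_pattern2E => //; apply: contraT => nu1.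
(* A block of [w] consisting of [k.+1] letters 2 would make the windows of length [k] at [i] and
   [i.+1] equal. *)
have all2 c : c < k.+1 -> nth 0 u c = 2.
  rewrite -su => hc; have := nth_word_over u2 hc.
  have : nth 0 u c != 1 by apply: contraNneq nu1 => <-; apply: mem_nth.
  lia.
have /infix_nthP [i] := uw; rewrite su => hi equ.
suff : i = i.+1 by lia.
apply: inj_w => [||c hc]; [lia|lia|].
by rewrite addSn -addnS -!equ ?all2 //; lia.
Qed.
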